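(* Let $a,b,c,m,n$ be positive integers with $1\le a<2^{n+1}$, $m\ge n+2+\lfloor\log_2 b\rfloor$ and $c$ odd. Then: if $a=2^{n+1}-1$, $$\nu_2\big(S(c2^m+b2^{n+1}+2^n,\ b2^{n+2}+a)\big)=n;$$ if $a<2^{n+1}-1$, $$\nu_2\big(S(c2^m+b2^{n+1}+2^n,\ b2^{n+2}+a)\big)\ge s_2(a).$$
   Context: $S(n,k)$ denotes the Stirling number of the second kind: the number of partitions of an $n$-element set into exactly $k$ nonempty subsets. $\nu_2(m)$ denotes the 2-adic valuation of $m$ (the exponent of the highest power of 2 dividing $m$). $s_2(m)$ denotes the sum of the binary digits of the nonnegative integer $m$. $\lfloor x\rfloor$ is the largest integer not exceeding $x$. *)

(* Defs.v *)
From mathcomp Require Import all_boot.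

Set Implicit Arguments.
Unset Strict Implicit.
Unset Printing Implicit Defensive.

(* [partition P A] requires the blocks to be nonempty ([set0 \notin P]). *)
Definition stirling2 (n k : nat) : nat :=
  #|[set P : {set {set 'I_n}} | partition P [set: 'I_n] & #|P| == k]|.

(* The binary digit of index i is [(m %/ 2 ^ i) %% 2]; it vanishes for i >= m,
   since m < 2 ^ m, so the bound i < m loses no digit. *)
Definition binary_digit_sum (m : nat) : nat :=
  \sum_(i < m) (m %/ 2 ^ i) %% 2.

(* Main.v *)
Require Import Defs.
From mathcomp Require Import all_boot all_order all_algebra.
From mathcomp Require Import ring zify.

(** The generating function identity 'X^N = \sum_k S(N, k) fall 0 k, where
    fall 0 k = X (X - 1) ... (X - k + 1), shows that S(N, K) is the sum of the
    residues of X^N / fall 0 K.+1.  Put L = (2 b + 1) 2^(n+1) and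
    l = 2^(n+1) - 1 - a.  Extending this fraction by the l missing factors T, the
    denominator becomes fall 0 L, which is congruent modulo 2^(n+1) to the
    (2 b + 1)-th power of fall 0 (2^(n+1)); the latter is congruent to
    (X^2 (X^2 - 1))^(2^(n-1)) modulo 2^n, and its odd part is explicit modulo
    2^(n+1).  With Z = X^2, M = c 2^(m-1) and D = (2 b + 1) 2^(n-1) this leaves
    the residue at Z = 1 of Z^M U(Z) / (Z - 1)^D, where U(X^2) X is the odd part of
    T.

    If l = 0 then T = 1 and only the odd part of the denominator contributes: the
    result is 2^n 'C(M - 1, D - 1) modulo 2^(n+1), with an odd binomial.  If l > 0,
    then T has an antiderivative whose denominators divide 2^(s_2(l)) up to odd
    factors, and integrating the residue by parts gains the factor
    2^(n+1), so that S(N, K) is divisible by 2^(n+1-s_2(l)) = 2^(s_2(a)). *)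

Set Implicit Arguments.
Unset Strict Implicit.
Unset Printing Implicit Defensive.

Import GRing.Theory.

(** * Stirling numbers: counting maps by their kernels *)

(** A map with kernel [P] factors uniquely through an injection of the set of blocks into [R], and
    [#|R| ^_ #|P|] counts these injections. *)
Lemma card_ffun_kernel (T R : finType) (P : {set {set T}}) :
  partition P [set: T] ->
  #|[set f : {ffun T -> R} | preim_partition f [set: T] == P]| = #|R| ^_ #|P|.
Proof.
move=> parP; have /and3P[/eqP covP tiP P0] := parP.
have inP i : pblock P i \in P by rewrite pblock_mem ?covP ?inE.
pose S := {B : {set T} | B \in P}.
pose blk i : S := exist _ (pblock P i) (inP i).
have [k blkK] : exists k : S -> T, forall B, blk (k B) = B.
  apply: (fin_all_exists (P := fun B i => blk i = B)) => -[B BP].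
  have /set0Pn[i iB] : B != set0 by apply: contraNneq P0 => <-.
  by exists i; apply: val_inj; rewrite /= (def_pblock tiP BP iB).
pose h (g : {ffun S -> R}) := [ffun i => g (blk i)] : {ffun T -> R}.
have h_inj : injective h.
  move=> g1 g2 /ffunP eq_h; apply/ffunP => B.
  by have := eq_h (k B); rewrite !ffunE blkK.
rewrite (_ : #|P| = #|{: S}|); last by rewrite card_sig.
rewrite -card_inj_ffuns -(card_imset _ h_inj).
apply: eq_card => f; rewrite inE; apply/eqP/imsetP => [kerf | [g]].
  have f_blk i j : (f i == f j) = (blk i == blk j).
    rewrite -val_eqE /= eq_pblock ?covP ?inE //.
    by rewrite -kerf pblock_equivalence_partition ?inE // => ? ? ? _ _ _; split=> // /eqP->.
  exists [ffun B => f (k B)].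
    rewrite inE; apply/injectiveP => B1 B2; rewrite !ffunE => /eqP.
    by rewrite f_blk !blkK => /eqP.
  apply/ffunP => i; rewrite !ffunE; apply/eqP.
  by rewrite f_blk blkK.
rewrite inE => /injectiveP g_inj ->.
rewrite -[RHS](preim_partition_pblock parP).
apply: eq_imset => i; apply/setP => j; rewrite !inE /= !ffunE.
by rewrite (inj_eq g_inj) -val_eqE.
Qed.

Lemma leq_card_partition (T : finType) (P : {set {set T}}) (D : {set T}) :
  partition P D -> #|P| <= #|D|.
Proof.
move=> parP; rewrite (card_partition parP) -sum1_card; apply: leq_sum => B BP.
rewrite card_gt0; have /and3P[_ _] := parP.
by apply: contraNneq => <-.
Qed.

(** The maps from ['I_N] to ['I_x] are sorted by kernel, and the kernels by their number of
    blocks. *)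
Lemma expn_stirling2 (N x : nat) :
  x ^ N = \sum_(k < N.+1) stirling2 N k * x ^_ k.
Proof.
pose ker (f : {ffun 'I_N -> 'I_x}) := preim_partition f [set: 'I_N].
have kerP f : partition (ker f) [set: 'I_N] by apply: preim_partitionP.
rewrite -{1}(card_ord x) -{1}(card_ord N) -card_ffun -sum1_card.
rewrite (partition_big ker (fun P => partition P [set: 'I_N])) //=.
have lePN P : partition P [set: 'I_N] -> #|P| < N.+1.
  by move=> /leq_card_partition; rewrite cardsT card_ord ltnS.
rewrite (partition_big (fun P : {set {set 'I_N}} => inord #|P| : 'I_N.+1) xpredT) //=.
apply: eq_bigr => k _; rewrite /stirling2 -sum1_card big_distrl /=.
apply: eq_big => P.
  rewrite inE -val_eqE /=; case: (boolP (partition P _)) => //= /lePN ltPN.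
  by rewrite inordK.
case/andP=> parP /eqP <-; rewrite inordK ?lePN // mul1n.
have := card_ffun_kernel 'I_x parP; rewrite card_ord => <-.
by rewrite -sum1_card; apply: eq_bigl => f; rewrite inE.
Qed.

(** * Congruences in a commutative ring *)

Section Congruences.

Local Open Scope ring_scope.

Variable R : comNzRingType.
Implicit Types d x y z : R.

Definition cong d x y := exists e, x = y + d * e.

Lemma cong_refl d x : cong d x x.
Proof. by exists 0; rewrite mulr0 addr0. Qed.

Lemma cong_trans d x y z : cong d x y -> cong d y z -> cong d x z.
Proof. by case=> e -> [f ->]; exists (e + f); ring. Qed.

Lemma congM d x y x' y' : cong d x y -> cong d x' y' -> cong d (x * x') (y * y').
Proof. by case=> e -> [f ->]; exists (e * y' + y * f + d * e * f); ring. Qed.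

Lemma congX d x y k : cong d x y -> cong d (x ^+ k) (y ^+ k).
Proof.
move=> xy; elim: k => [|k IHk]; first exact: cong_refl.
by rewrite !exprS; apply: congM.
Qed.

Lemma cong_prod d n (F G : 'I_n -> R) :
  (forall i, cong d (F i) (G i)) -> cong d (\prod_i F i) (\prod_i G i).
Proof.
by move=> FG; apply: (big_ind2 (cong d)); [apply: cong_refl|apply: congM|].
Qed.

Lemma cong_dvd d d' x y : cong (d * d') x y -> cong d x y.
Proof. by case=> e ->; exists (d' * e); ring. Qed.

End Congruences.

(* The generalization matches sizes up to conversion, which [lia] does not: the
   coefficient ring may come through different structure instances. *)
Ltac lia_size :=
  repeat match goal with H : is_true (leq _ _) |- _ => revert H end;
  repeat match goal with H : @eq nat _ _ |- _ => revert H end;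
  repeat match goal with |- context [size (polyseq ?p)] =>
    let k := fresh in move: (size p) => k end; lia.

(** * Residues of fractions with monic denominator *)

Section Residue.

Local Open Scope ring_scope.
Import Pdiv.Ring Pdiv.RingMonic.

Variable R : comNzRingType.
Implicit Types p q f g r : {poly R}.

(* For monic [p] this is the coefficient of 1/X in the expansion of [f / p] in
   powers of 1/X, that is, the sum of the residues of [f / p] at finite points. *)
Definition res p f := (rmodp f p)`_(size p).-2.

Lemma resP p f : p \is monic ->
  exists g r, [/\ f = g * p + r, (size r < size p)%N & res p f = r`_(size p).-2].
Proof.
move=> mp; exists (rdivp f p), (rmodp f p); split=> //.
  exact: rdivp_eq.
by rewrite ltn_rmodpN0 // monic_neq0.
Qed.

Lemma res_unique p g r : p \is monic -> (size r < size p)%N ->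
  res p (g * p + r) = r`_(size p).-2.
Proof. by move=> mp ltrp; rewrite /res rmodp_addl_mul_small. Qed.

Lemma resD p f g : p \is monic -> res p (f + g) = res p f + res p g.
Proof. by move=> mp; rewrite /res rmodpD // coefD. Qed.

Lemma resZ p c f : p \is monic -> res p (c *: f) = c * res p f.
Proof. by move=> mp; rewrite /res rmodpZ // coefZ. Qed.

Lemma res_sum p n (F : 'I_n -> {poly R}) : p \is monic ->
  res p (\sum_i F i) = \sum_i res p (F i).
Proof. by move=> mp; rewrite /res rmodp_sum // coef_sum. Qed.

(** Both sides belong to the same fraction; since [q] is monic, the relevant coefficient of the
    remainder survives multiplication by [q]. *)
Lemma res_mulr p q f : p \is monic -> q \is monic ->
  res (p * q) (f * q) = res p f.
Proof.
move=> mp mq; have [g [r [-> ltr ->]]] := resP f mp.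
have q0 : (size q > 0)%N by rewrite size_poly_gt0 monic_neq0.
have p0 : (size p > 0)%N by rewrite size_poly_gt0 monic_neq0.
have szpq : size (p * q) = (size p + size q).-1 by rewrite size_monicM ?monic_neq0.
have ltrq : (size (r * q)%R < size (p * q)%R)%N.
  rewrite szpq; apply: leq_ltn_trans (size_polyMleq _ _) _; lia.
rewrite mulrDl -mulrA res_unique ?monicMr // szpq.
case: (ltnP 1 (size p)) => [p1|p1]; last first.
  rewrite (_ : r = 0) ?mul0r ?coef0 //.
  by apply/eqP; rewrite -size_poly_leq0; lia_size.
have -> : (size p + size q).-1.-2 = ((size p).-2 + (size q).-1)%N by lia.
have ltrp : (size r <= (size p).-2.+1)%N by lia.
have ltq : (size q <= (size q).-1.+1)%N by lia.
rewrite coefM (bigD1 (inord (size p).-2)) //= inordK; last lia.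
rewrite addKn -/(lead_coef q) (monicP mq) mulr1 big1 ?addr0 // => i ne_i.
have {ne_i} : (i != (size p).-2 :> nat).
  by apply: contraNneq ne_i => Di; apply/eqP/val_inj; rewrite /= Di inordK //; lia.
move: (nat_of_ord i) => j ne_j; case: (ltnP j (size p).-2) => ltj.
  by rewrite [q`__]nth_default ?mulr0 //; lia_size.
by rewrite [r`__]nth_default ?mul0r //; move: ne_j; lia_size.
Qed.

(** Replacing [p] by [p'] in [f = g * p + r] changes the right side only by a multiple of [d], with
    the same remainder [r]. *)
Lemma res_cong_mod p p' d f : p \is monic -> p' \is monic -> size p = size p' ->
  cong d%:P p p' -> cong d (res p f) (res p' f).
Proof.
move=> mp mp' szp [e Dp]; have [g [r [Df ltr ->]]] := resP f mp.
have -> : f = (d *: (g * e)) + (g * p' + r).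
  by rewrite Df Dp -mul_polyC; ring.
rewrite resD // resZ // res_unique -?szp //.
by exists (- res p' (g * e)); ring.
Qed.

End Residue.

(** * Integer residues under Z = X^2 and under translation *)

Section ResidueInt.

Local Open Scope ring_scope.
Implicit Types p f r : {poly int}.

Lemma monic_comp p q : p \is monic -> q \is monic -> (size (q : {poly int}) > 1)%N ->
  p \Po q \is monic.
Proof.
move=> mp mq szq; rewrite monicE lead_coef_comp // (monicP mp) (monicP mq).
by rewrite mul1r expr1n.
Qed.

Lemma X1_monic : ('X - 1 : {poly int}) \is monic.
Proof. by rewrite -[1]/(1%:P) monicXsubC. Qed.

Lemma size_monic_exp p j : p \is monic -> size (p ^+ j) = ((size p).-1 * j).+1.
Proof.
by move=> mp; rewrite -size_exp prednK // size_poly_gt0 monic_neq0 ?monic_exp.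
Qed.

Lemma monic_compX2 p : p \is monic -> p \Po 'X^2 \is monic.
Proof. by move=> mp; rewrite monic_comp ?monicXn ?size_polyXn. Qed.

Lemma size_compX2 r : size (r \Po 'X^2) = (size r).*2.-1.
Proof.
case: (eqVneq r 0) => [->|r0]; first by rewrite comp_poly0 size_poly0.
have r0' : r \Po 'X^2 != 0 by rewrite comp_poly_eq0 ?size_polyXn.
have := size_comp_poly r 'X^2; rewrite size_polyXn /=.
move: r0 r0'; rewrite -!size_poly_gt0.
by move: (size r) (size (r \Po 'X^2)) => a b; lia.
Qed.

(** An even fraction expands in even powers of 1/X only. *)
Lemma res_even p f : p \is monic -> res (p \Po 'X^2) (f \Po 'X^2) = 0.
Proof.
move=> mp; have [g [r [-> ltr _]]] := resP f mp.
rewrite comp_polyD comp_polyM res_unique ?monic_compX2 //; last first.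
  by rewrite !size_compX2; lia_size.
have [p1|p1] := leqP (size p) 1.
  have -> : r = 0 by apply/eqP; rewrite -size_poly_leq0; lia_size.
  by rewrite comp_poly0 coef0.
by rewrite size_compX2 coef_comp_poly_Xn // ifN // dvdn2; lia_size.
Qed.

(** With Z = X^2, the term 1/Z of the fraction turns into X / X^2 = 1/X. *)
Lemma res_odd p f : p \is monic ->
  res (p \Po 'X^2) ((f \Po 'X^2) * 'X) = res p f.
Proof.
move=> mp; have [g [r [-> ltr ->]]] := resP f mp.
rewrite comp_polyD comp_polyM mulrDl mulrAC res_unique ?monic_compX2 //; last first.
  case: (eqVneq r 0) ltr => [->|r0] ltr.
    by rewrite comp_poly0 mul0r size_poly0 size_compX2; move: ltr; rewrite size_poly0; lia_size.
  by rewrite size_mulX ?comp_poly_eq0 ?size_polyXn // !size_compX2; move: r0; rewrite -size_poly_gt0; lia_size.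
have [p1|p1] := leqP (size p) 1.
  have -> : r = 0 by apply/eqP; rewrite -size_poly_leq0; lia_size.
  by rewrite comp_poly0 mul0r !coef0.
rewrite size_compX2 coefMX ifN ?coef_comp_poly_Xn //; last lia_size.
have -> : (size p).*2.-1.-2.-1 = ((size p).-2 * 2)%N by lia_size.
by rewrite dvdn_mull // mulnK.
Qed.

Lemma coef_top_shift (r : {poly int}) k : (size r <= k.+1)%N ->
  (r \Po ('X + 1))`_k = r`_k.
Proof.
have szX1 : size ('X + 1 : {poly int}) = 2 by rewrite size_XaddC.
rewrite leq_eqVlt => /predU1P[szr|szr].
  have := lead_coef_comp r (q := 'X + 1); rewrite szX1 => /(_ isT).
  rewrite !lead_coefE size_comp_poly szr szX1 /= muln1 => ->.
  by rewrite coefD coefX coef1 /= expr1n mulr1.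
rewrite !nth_default //.
have [->|r0] := eqVneq r 0; first by rewrite comp_poly0 size_poly0.
have := size_comp_poly r ('X + 1); rewrite szX1.
by have := r0; rewrite -size_poly_gt0; lia_size.
Qed.

(** The only pole is 1; moving it to 0 makes the residue a Taylor coefficient. *)
Lemma res_shift D f : (D > 0)%N ->
  res (('X - 1) ^+ D) f = (f \Po ('X + 1))`_D.-1.
Proof.
move=> D0; have m1 := X1_monic.
have mp : ('X - 1 : {poly int}) ^+ D \is monic by rewrite monic_exp.
have szp : size (('X - 1 : {poly int}) ^+ D) = D.+1.
  by rewrite -[1]/(1%:P) size_exp_XsubC.
have [g [r [-> ltr ->]]] := resP f mp.
rewrite comp_polyD comp_polyM rmorphXn /= comp_polyB comp_polyX comp_polyC.
rewrite addrK coefD coefMXn szp ifT ?add0r; last lia_size.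
by rewrite coef_top_shift //; lia_size.
Qed.

End ResidueInt.

(** * Falling factorial polynomials *)

Section Falling.

Local Open Scope ring_scope.

Definition fall (c : int) (k : nat) : {poly int} :=
  \prod_(i < k) ('X - (c + i%:R)%:P).

Lemma fall_cat c k l : fall c (k + l) = fall c k * fall (c + k%:R) l.
Proof.
rewrite /fall big_split_ord /=; congr (_ * _); apply: eq_bigr => i _.
by rewrite natrD addrA.
Qed.

Lemma fallS c k : fall c k.+1 = fall c k * ('X - (c + k%:R)%:P).
Proof. by rewrite /fall big_ord_recr. Qed.

Lemma fall_monic c k : fall c k \is monic.
Proof. by apply: monic_prod => i _; apply: monicXsubC. Qed.

Lemma size_fall c k : size (fall c k) = k.+1.
Proof. by rewrite size_prod_XsubC /index_enum -enumT size_enum_ord. Qed.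

Lemma fall_shift c k d : fall c k \Po ('X - d%:P) = fall (c + d) k.
Proof.
rewrite /fall rmorph_prod; apply: eq_bigr => i _ /=.
by rewrite comp_polyB comp_polyX comp_polyC !polyCD; ring.
Qed.

Lemma cong_fall d c c' k : cong d c c' -> cong d%:P (fall c k) (fall c' k).
Proof.
by case=> e ->; apply: cong_prod => i; exists (- e%:P); rewrite !polyCD polyCM; ring.
Qed.

Lemma horner_fall0 k x : (fall 0 k).[x%:R] = (x ^_ k)%:R.
Proof.
elim: k => [|k IHk]; first by rewrite /fall big_ord0 hornerC ffactn0.
rewrite fallS hornerM IHk hornerXsubC add0r ffactnSr.
have [lekx|ltxk] := leqP k x; first by rewrite natrM natrB.
by rewrite ffact_small // mul0n mul0r.
Qed.

Lemma poly_nat_eq0 (p : {poly int}) : (forall x : nat, p.[x%:R] = 0) -> p = 0.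
Proof.
move=> p0; apply/eqP; apply: contraT => nz_p.
have := max_poly_roots (rs := [seq i%:R | i <- iota 0 (size p)]) nz_p.
rewrite size_map size_iota ltnn; apply.
  by apply/allP => _ /mapP[i _ ->]; rewrite /root p0.
by rewrite map_inj_uniq ?iota_uniq // => i j; rewrite !natz => -[].
Qed.

Lemma Xn_stirling2 N : 'X^N = \sum_(k < N.+1) (stirling2 N k)%:R *: fall 0 k.
Proof.
apply/eqP; rewrite -subr_eq0; apply/eqP/poly_nat_eq0 => x.
rewrite hornerD hornerN hornerXn horner_sum -natrX expn_stirling2 natr_sum.
apply/eqP; rewrite subr_eq0; apply/eqP; apply: eq_bigr => k _.
by rewrite hornerZ horner_fall0 natrM.
Qed.

(** For k > K the fraction is a polynomial, for k < K it decays too fast. So the residue reads off a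
    coordinate in the falling factorial basis. *)
Lemma res_fall K k : res (fall 0 K.+1) (fall 0 k) = (k == K)%:R.
Proof.
have mK := fall_monic 0 K.+1.
case: (ltngtP k K) => [ltkK|ltKk|->].
- rewrite -[fall 0 k](add0r) -(mul0r (fall 0 K.+1)) res_unique ?size_fall //.
    by rewrite nth_default // size_fall.
  by rewrite !ltnS ltnW.
- rewrite -(subnKC ltKk) fall_cat -[_ * _]addr0 mulrC res_unique ?coef0 //.
  by rewrite size_poly0 size_fall.
- rewrite -[fall 0 K](add0r) -(mul0r (fall 0 K.+1)) res_unique ?size_fall //.
  by have := monicP (fall_monic 0 K); rewrite lead_coefE size_fall.
Qed.

Lemma stirling2_res N K : (stirling2 N K)%:R = res (fall 0 K.+1) 'X^N :> int.
Proof.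
rewrite Xn_stirling2 res_sum ?fall_monic //.
under eq_bigr => k _ do rewrite resZ ?fall_monic // res_fall mulr_natr.
have [leKN|ltNK] := ltnP K N.+1.
  rewrite (bigD1 (Ordinal leKN)) //= eqxx mulr1n big1 ?addr0 // => k.
  by rewrite -val_eqE /= => /negPf->.
rewrite big1 => [|k _]; last first.
  by rewrite (_ : _ == _ = false) //; apply/negbTE; have := ltn_ord k; lia.
suff -> : stirling2 N K = 0%N by [].
apply: eq_card0 => P; rewrite inE; apply/andP => -[parP /eqP cardP].
have := leq_card_partition parP.
by rewrite cardP cardsT card_ord leqNgt ltNK.
Qed.

Lemma stirling2S N K :
  stirling2 N.+1 K.+1 = (stirling2 N K + K.+1 * stirling2 N K.+1)%N.
Proof.
suff : ((stirling2 N.+1 K.+1)%:R = (stirling2 N K + K.+1 * stirling2 N K.+1)%:R :> int).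
  by rewrite !natz => -[].
have XfallS k : 'X * fall 0 k = fall 0 k.+1 + k%:R *: fall 0 k.
  by rewrite fallS add0r -mul_polyC; ring.
have mK := fall_monic 0 K.+2.
rewrite stirling2_res exprS (Xn_stirling2 N) mulr_sumr res_sum //.
under eq_bigr => k _.
  rewrite -scalerAr XfallS resZ // resD // resZ // !res_fall eqSS mulrDr.
  over.
rewrite big_split /= natrD natrM !stirling2_res Xn_stirling2 !res_sum ?fall_monic //.
congr (_ + _).
  by apply: eq_bigr => k _; rewrite resZ ?fall_monic // res_fall.
rewrite mulr_sumr; apply: eq_bigr => k _; rewrite resZ // res_fall.
by case: eqP => [->|_]; rewrite ?mulr0 // !mulr1 mulrC.
Qed.

(** Positivity matters because [logn 2 0 = 0]: divisibility bounds the valuation from below only for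
    nonzero numbers. *)
Lemma stirling2_gt0 N K : (0 < K <= N)%N -> (0 < stirling2 N K)%N.
Proof.
have S0 : stirling2 0 0 = 1%N.
  suff : (stirling2 0 0)%:R = 1 :> int by rewrite natz => -[].
  by rewrite stirling2_res (_ : 'X^0 = fall 0 0) ?res_fall // /fall big_ord0.
have SN n : (0 < stirling2 n n)%N.
  by elim: n => [|n IHn]; rewrite ?S0 // stirling2S addn_gt0 IHn.
case: K => // K; elim: N K => // N IHN K.
rewrite stirling2S addn_gt0 /= ltnS => leKN.
case: (ltngtP K N) leKN => // [ltKN|->] _.
  by rewrite muln_gt0 IHN ?orbT.
by rewrite SN.
Qed.

(** Each window of [m] consecutive factors starts at a multiple of [m], hence is congruent to the
    first. *)
Lemma cong_fall_pow m k : cong m%:R%:P (fall 0 (m * k)) (fall 0 m ^+ k).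
Proof.
elim: k => [|k IHk]; first by rewrite muln0 /fall big_ord0; apply: cong_refl.
rewrite mulnS addnC fall_cat exprSr; apply: congM => //; apply: cong_fall.
by exists k%:R; rewrite !add0r natrM.
Qed.

(* Multiplying numerator and denominator of X^N / fall 0 K.+1 by the factors
   [fall K.+1 l] completes the denominator to k full periods modulo m. *)
Lemma stirling2_cong m k N K l : (K.+1 + l = m * k)%N ->
  cong m%:R (stirling2 N K)%:R (res (fall 0 m ^+ k) ('X^N * fall K.+1%:R l)).
Proof.
move=> Dl; rewrite stirling2_res -(res_mulr _ _ (fall_monic K.+1%:R l)) ?fall_monic //.
have -> : fall 0 K.+1 * fall K.+1%:R l = fall 0 (m * k).
  by rewrite -Dl fall_cat add0r.
apply: res_cong_mod; rewrite ?fall_monic ?monic_exp ?fall_monic ?size_fall //.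
  have := size_exp (fall 0 m) k; rewrite size_fall /= => <-.
  by rewrite prednK // size_poly_gt0 monic_neq0 ?monic_exp ?fall_monic.
exact: cong_fall_pow.
Qed.

End Falling.

(** * Falling factorials of length 2^s modulo powers of 2 *)

Section Blocks.

Local Open Scope ring_scope.

Lemma polyC_pow2 k : ((2 ^ k)%N%:R : int)%:P = 2 ^+ k :> {poly int}.
Proof. by rewrite natrX rmorphXn /= polyC_natr. Qed.

Lemma comp_shift_taylor (p : {poly int}) (c : int) : exists q : {poly int},
  p \Po ('X - c%:P) = p - c%:P * p^`() + c%:P ^+ 2 * q.
Proof.
elim/poly_ind: p => [|p a [q IHp]].
  by exists 0; rewrite comp_poly0 derivC; ring.
exists (p^`() + q * ('X - c%:P)).
rewrite comp_poly_MXaddC IHp derivD derivC derivM derivX.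
by ring.
Qed.

(** Doubling: the second half is q = p + 2^s f, so 2 (p q)' is the sum of 4 p p', 2^(s+1) p f' and
    2^s f (2 p'), all divisible by 2^(s+1) when s > 0. *)
Lemma deriv_fall_pow2 c s :
  cong (2 ^+ s) (2 * (fall c (2 ^ s))^`()) 0.
Proof.
elim: s c => [|s IHs] c.
  by rewrite expr0; exists (2 * (fall c (2 ^ 0))^`()); ring.
rewrite expnS mul2n -addnn fall_cat derivM.
have [e De] := IHs c; have [e' De'] := IHs (c + (2 ^ s)%:R).
have [f Df] : cong (2 ^+ s) (fall (c + (2 ^ s)%:R) (2 ^ s)) (fall c (2 ^ s)).
  by rewrite -polyC_pow2; apply: cong_fall; exists 1; rewrite mulr1.
(* For s = 0 the third term has no spare factor 2, so this case is computed directly. *)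
case: s IHs De De' Df => [|s] _ De De' Df.
  rewrite /fall !expn0 !big_ord1 !derivXsubC.
  by exists ('X - (c + 1 + 0)%:P + ('X - (c + 0)%:P)); rewrite /=; ring.
set p := fall c _ in De Df *; set q := fall _ _ in De' Df *.
have [g Dg] : exists g, 2 ^+ s.+1 * (q^`() - p^`()) = 2 ^+ s.+1 * (2 ^+ s.+1 * g).
  exists f^`().
  rewrite Df derivD derivM -polyC_pow2 derivC polyC_pow2; ring.
have nz2 k : (2 ^+ k : {poly int}) != 0.
  by rewrite expf_neq0 // -polyC_natr polyC_eq0.
have Dq : q^`() = p^`() + 2 ^+ s.+1 * g.
  by rewrite -(mulfI (nz2 _) Dg); ring.
exists (e * p + 2 ^+ s * e * f + g * p).
rewrite Dq {}Df mulrDr mulrA mulrDr.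
have -> : 2 * (p * (p^`() + 2 ^+ s.+1 * g)) = (2 * p^`()) * p + 2 * 2 ^+ s.+1 * g * p.
  by ring.
rewrite De !exprS; ring.
Qed.

(** Both blocks are polynomials in Z = X^2; [odd_block s] is [sq_block s] divided by Z. *)
Definition sq_block s : {poly int} := ('X * ('X - 1)) ^+ (2 ^ s).
Definition odd_block s : {poly int} := 'X^((2 ^ s).-1) * ('X - 1) ^+ (2 ^ s).

Lemma sq_blockS s : sq_block s.+1 = sq_block s ^+ 2.
Proof. by rewrite /sq_block expnSr exprM. Qed.

Lemma odd_blockS s : odd_block s.+1 = sq_block s * odd_block s.
Proof.
rewrite /odd_block /sq_block expnSr muln2 -addnn exprMn.
have -> : (2 ^ s + 2 ^ s).-1 = (2 ^ s + (2 ^ s).-1)%N.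
  by rewrite -[in RHS]subn1 addnBA ?expn_gt0 // subn1.
by rewrite !exprD; ring.
Qed.

Lemma sq_block_monic s : sq_block s \is monic.
Proof.
by rewrite monic_exp // monicMl ?monicX ?X1_monic.
Qed.

Lemma size_sq_block s : size (sq_block s) = (2 ^ s.+1).+1.
Proof.
have mX1 := X1_monic.
have szX1 : size ('X - 1 : {poly int}) = 2 by rewrite -[1]/(1%:P) size_XsubC.
rewrite -[LHS]prednK ?size_poly_gt0 ?monic_neq0 ?sq_block_monic //.
rewrite /sq_block size_exp size_monicM ?monicX ?monic_neq0 //.
by rewrite size_polyX szX1 expnS.
Qed.

(* Modulo [2 ^ s.+2] the polynomial [fall 0 (2 ^ s.+2)] fails to be even only
   through the term carrying the factor [2 ^ s.+1]. *)
Lemma fall_block s : exists P F : {poly int},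
  [/\ fall 0 (2 ^ s.+2) = (P \Po 'X^2) + 2 ^+ s.+1 * ((odd_block s \Po 'X^2) * 'X)
                          + 2 ^+ s.+2 * F,
      cong (2 ^+ s.+1) P (sq_block s), P \is monic & size P = (2 ^ s.+1).+1].
Proof.
elim: s => [|s [P [F [DB [e De] mP szP]]]].
  (* Here fall 0 4 = X^4 - 6 X^3 + 11 X^2 - 6 X, whose odd terms are 2 (X^2 - 1) X + 4 (- 2 X^3 -
     X). *)
  exists ('X ^+ 2 + 11%:P * 'X), (- 2 * 'X^3 - 'X).
  have szX2 : size ('X ^+ 2 : {poly int}) = 3 by rewrite size_polyXn.
  have lt : (size (11%:P * 'X : {poly int})%R < size ('X^2 : {poly int}))%N.
    by rewrite szX2 mul_polyC (leq_ltn_trans (size_scale_leq _ _)) // size_polyX.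
  split.
  - rewrite /sq_block /odd_block /fall.
    rewrite !big_ord_recr big_ord0 /= expn0 /= expr0 expr1 mul1r.
    rewrite ?mul1r comp_polyD comp_polyM ?rmorphXn /= comp_polyB -[1 \Po _]/(1%:P \Po _).
    rewrite !(comp_polyM, comp_polyC, comp_polyX) !add0r !polyC_natr; ring.
  - by exists (6 * 'X); rewrite /sq_block expn0 !expr1 polyC_natr; ring.
  - by rewrite monicE lead_coefDl // -monicE monicXn.
  - by rewrite size_polyDl.
have [C DC] := deriv_fall_pow2 0 s.+2.
have [q Dq] := comp_shift_taylor (fall 0 (2 ^ s.+2)) (2 ^ s.+2)%:R.
have nz2 : (2 : {poly int}) != 0 by rewrite -polyC_natr polyC_eq0.
have DB' : (fall 0 (2 ^ s.+2))^`() = 2 ^+ s.+1 * C.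
  by apply: (mulfI nz2); rewrite DC !exprS; ring.
have DB2 : fall 0 (2 ^ s.+3) = fall 0 (2 ^ s.+2) * (fall 0 (2 ^ s.+2) \Po ('X - ((2 ^ s.+2)%:R)%:P)).
  by rewrite fall_shift !add0r expnSr muln2 -addnn fall_cat add0r.
have szW : (size (odd_block s) = 2 ^ s.+1)%N.
  rewrite /odd_block mulrC size_mulXn; last first.
    by rewrite expf_neq0 // -[1]/(1%:P) polyXsubC_eq0.
  by rewrite -[1]/(1%:P) size_exp_XsubC expnS; have := expn_gt0 2 s; lia.
rewrite polyC_pow2 in Dq DB2; rewrite odd_blockS sq_blockS.
have Y_P : sq_block s = P - 2 ^+ s.+1 * e by rewrite De; ring.
move: (odd_block s) (sq_block s) DB De Y_P szW => W Y DB De Y_P szW.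
have comp2 k : 2 ^+ k \Po 'X^2 = 2 ^+ k :> {poly int}.
  by rewrite -polyC_pow2 comp_polyC.
(* Modulo 2^(s+3) the product of B = [fall 0 (2 ^ s.+2)] and its shift is B^2, since 2^(s+1) divides
   B'. The square of the odd term of B is even and joins [P]; the cross term gives the new odd
   term. *)
exists (P * P + 2 ^+ (s.+1 + s.+1) * ('X * (W * W))).
set B := fall 0 (2 ^ s.+2) in DB Dq DB' DB2.
exists (2 ^+ s.+1 * F ^+ 2 + (P \Po 'X^2) * F
        + 2 ^+ s.+1 * (W \Po 'X^2) * 'X * F
        + 2 ^+ s * (e \Po 'X^2) * (W \Po 'X^2) * 'X
        - 2 ^+ s * B * C + 2 ^+ s.+1 * q * B).
have szPP : (size (P * P)%R = (2 ^ s.+2).+1)%N.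
  transitivity (size P + size P).-1%N; first by rewrite size_monicM ?monic_neq0.
  by rewrite szP [in RHS]expnS; lia.
have ltW : (size (2 ^+ (s.+1 + s.+1) * ('X * (W * W)))%R < size (P * P)%R)%N.
  rewrite szPP -polyC_pow2 mul_polyC.
  apply: leq_ltn_trans (size_scale_leq _ _) _.
  apply: leq_ltn_trans (size_polyMleq _ _) _.
  rewrite size_polyX; have := size_polyMleq W W; rewrite szW.
  by have := expn_gt0 2 s.+1; rewrite [in X in _ -> _ -> X]expnS; move: (size _) => k; lia.
split.
- rewrite DB2 Dq DB' Y_P !(comp_polyB, comp_polyD, comp_polyM) !comp2 !comp_polyX.
  rewrite DB !exprD !(exprS (2 : {poly int})); ring.
- exists (Y * e + 2 ^+ s * e ^+ 2 + 2 ^+ s * ('X * (W * W))).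
  by rewrite De exprD !exprS; ring.
- by rewrite monicE lead_coefDl // -monicE monicMl.
- by rewrite size_polyDl // szPP.
Qed.

End Blocks.

(** * Binary digit sums with a fixed number of digits *)

Section DigitSums.

Definition digit_sum (r x : nat) : nat := \sum_(i < r) (x %/ 2 ^ i) %% 2.

Lemma digit_sum_recl r x : digit_sum r.+1 x = x %% 2 + digit_sum r (x %/ 2).
Proof.
rewrite /digit_sum big_ord_recl divn1; congr (_ + _).
by apply: eq_bigr => i _; rewrite -divnMA expnS.
Qed.

Lemma digit_sum_recr r x : digit_sum r.+1 x = digit_sum r x + (x %/ 2 ^ r) %% 2.
Proof. by rewrite /digit_sum big_ord_recr. Qed.

Lemma digit_sum_compl r x y : x + y = (2 ^ r).-1 -> digit_sum r x + digit_sum r y = r.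
Proof.
elim: r x y => [|r IHr] x y Dxy; first by rewrite /digit_sum !big_ord0.
have r0 := expn_gt0 2 r; rewrite !digit_sum_recl.
have D : x %/ 2 + y %/ 2 = (2 ^ r).-1 by move: Dxy r0; rewrite expnS; lia.
have := IHr _ _ D; move: Dxy r0; rewrite expnS; lia.
Qed.

Lemma digit_sum_addl r y : digit_sum r (2 ^ r + y) = digit_sum r y.
Proof.
elim: r y => [|r IHr] y; first by rewrite /digit_sum !big_ord0.
rewrite !digit_sum_recl expnS; have -> : (2 * 2 ^ r + y) %/ 2 = 2 ^ r + y %/ 2 by lia.
by rewrite IHr; lia.
Qed.

Lemma digit_sum_binary r x : x < 2 ^ r -> binary_digit_sum x = digit_sum r x.
Proof.
have ext k j : x < 2 ^ k -> digit_sum (k + j) x = digit_sum k x.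
  move=> ltx; elim: j => [|j IHj]; first by rewrite addn0.
  rewrite addnS digit_sum_recr IHj divn_small ?mod0n ?addn0 //.
  by rewrite (leq_trans ltx) // leq_exp2l // leq_addr.
move=> ltxr; have ltxx : x < 2 ^ x by rewrite ltn_expl.
rewrite -[LHS]/(digit_sum x x).
by have := ext r x ltxr; rewrite addnC ext.
Qed.

Lemma digit_sum_gt0 r x : 0 < x < 2 ^ r -> 0 < digit_sum r x.
Proof.
elim: r x => [|r IHr] x; first by case: x => [|[]].
rewrite digit_sum_recl expnS => x_bnd.
case: (posnP (x %/ 2)) => [x0|x0]; first by lia.
by have := IHr (x %/ 2); lia.
Qed.

End DigitSums.

(** * Antiderivatives with controlled denominators *)

Section Antiderivative.

Local Open Scope ring_scope.

Lemma poly_antideriv (p : {poly int}) :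
  (forall i, (i.+1%:Z %| p`_i)%Z) -> exists Q : {poly int}, Q^`() = p.
Proof.
move=> dvd_p; exists (\poly_(i < (size p).+1) (p`_i.-1 %/ i%:Z)%Z).
apply/polyP => i; rewrite coef_deriv coef_poly ltnS.
case: ltnP => [lti|lei]; last by rewrite mul0rn nth_default.
by rewrite -mulr_natr natz divzK.
Qed.

(** The odd part of (2^(s+1))! absorbs the odd part of [k], and the 2-part of [k] is at most 2^s. *)
Lemma odd_mul_pow2_dvd s : exists2 o, odd o &
  forall k, (0 < k < 2 ^ s.+1)%N -> (k %| o * 2 ^ s)%N.
Proof.
exists ((2 ^ s.+1)`!`_(2%N^'))%N.
  have := part_pnat 2%N^' (2 ^ s.+1)%N`!; rewrite p'natE // dvdn2 negbK //.
move=> k /andP[k0 ltk]; rewrite -{1}(partnC 2%N k0) mulnC dvdn_mul //.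
  by apply: partn_dvd; rewrite ?fact_gt0 ?dvdn_fact // k0 ltnW.
rewrite p_part dvdn_exp2l // -ltnS -(ltn_exp2l _ _ (ltnSn 1)).
by apply: leq_ltn_trans ltk; rewrite dvdn_leq // pfactor_dvdnn.
Qed.

Lemma antideriv_low s (p : {poly int}) : (size p < 2 ^ s.+1)%N ->
  exists o (Q : {poly int}), odd o /\ Q^`() = (o * 2 ^ s)%:R * p.
Proof.
move=> szp; have [o odd_o dvd_o] := odd_mul_pow2_dvd s.
exists o; suff [Q DQ] : exists Q : {poly int}, Q^`() = (o * 2 ^ s)%:R * p by exists Q.
apply: poly_antideriv => i; rewrite -polyC_natr mul_polyC coefZ.
have [ltip|leip] := ltnP i (size p); last by rewrite nth_default // mulr0 dvdz0.
by rewrite dvdz_mulr // natz dvdzE !absz_nat dvd_o //=; lia_size.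
Qed.

(* Writing [fall c (2 ^ r + y)] as [B * g] with [B := fall c (2 ^ r)] and
   integrating by parts, the remainder [B^`() * G] costs only [2 ^ r], because
   [2 * B^`()] is divisible by [2 ^ r] and degrees stay below [2 ^ r.+1]. *)
Lemma fall_antideriv r c x : (x < 2 ^ r)%N ->
  exists o (Q : {poly int}), odd o /\ Q^`() = (o * 2 ^ digit_sum r x)%:R * fall c x.
Proof.
elim: r c x => [|r IHr] c x.
  rewrite expn0 ltnS leqn0 => /eqP->; exists 1%N, 'X.
  by rewrite /digit_sum /fall !big_ord0 derivX mulr1.
have [ltx _|lex ltx] := ltnP x (2 ^ r).
  by rewrite digit_sum_recr divn_small // mod0n addn0; apply: IHr.
(* If all r + 1 digits of [x] are 1, the degree bound alone suffices. Otherwise x + 1 < 2^(r+1),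
   which keeps the degree of [C * G] low enough below. *)
have [x_max|x_max] := eqVneq x.+1 (2 ^ r.+1)%N.
  have := @digit_sum_compl r.+1 x 0.
  rewrite {2}/digit_sum big1 => [|i _]; last by rewrite div0n mod0n.
  rewrite !addn0 -x_max => /(_ erefl) ->.
  by apply: antideriv_low; rewrite size_fall expnS; move: x_max ltx; lia.
have r0 := expn_gt0 2 r.
have Dx : x = (2 ^ r + (x - 2 ^ r))%N by rewrite subnKC.
have lty : (x - 2 ^ r < 2 ^ r)%N by move: ltx; rewrite expnS; lia.
move: (x - 2 ^ r)%N Dx lty => y Dx lty; rewrite {}Dx in ltx x_max *.
rewrite fall_cat digit_sum_recr digit_sum_addl divnDl ?dvdnn // divnn r0 divn_small //.
rewrite /= addn1.
have [o1 [G [odd1 DG]]] := IHr (c + (2 ^ r)%:R) y lty.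
have [C DC] := deriv_fall_pow2 c r.
set B := fall c _ in DC *; set g := fall _ y in DG *; set d := digit_sum r y in DG *.
have szG : (size G <= y.+2)%N.
  apply/leq_sizeP => -[|j] // lej.
  have := congr1 (fun p : {poly int} => p`_j) DG.
  rewrite coef_deriv -polyC_natr mul_polyC coefZ [g`__]nth_default ?size_fall //.
  by rewrite mulr0 => /eqP; rewrite -mulr_natr mulf_eq0 natz eqz_nat orbF => /eqP.
have szC : (size C <= 2 ^ r)%N.
  apply/leq_sizeP => j lej.
  have := congr1 (fun p : {poly int} => p`_j) DC.
  rewrite add0r -polyC_pow2 -polyC_natr !mul_polyC !coefZ coef_deriv.
  rewrite [B`__]nth_default ?size_fall // mul0rn mulr0 => /esym/eqP.
  by rewrite mulf_eq0 natz eqz_nat eqn0Ngt r0 => /eqP.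
have [o2 [H [odd2 DH]]] : exists o (Q : {poly int}), odd o /\ Q^`() = (o * 2 ^ r)%:R * (C * G).
  apply: antideriv_low; apply: leq_ltn_trans (size_polyMleq _ _) _.
  by move: x_max ltx r0 szG szC; rewrite expnS; move: (size C) (size G) => k l; lia.
(* In the derivative, 2 o2 B' G = o2 2^r C G cancels against H'; what remains is 2 o2 B G', whose
   factor 2 accounts for the leading digit. *)
exists (o1 * o2)%N, (2 * o2%:R * B * G - H); split; first by rewrite oddM odd1.
rewrite derivB DH derivM DG -!mulrA.
have -> : (2 * (o2%:R * B) : {poly int})^`() = o2%:R * (2 * B^`()).
  by rewrite mulrCA derivM -!polyC_natr !derivM !derivC; ring.
rewrite DC !natrM !natrX exprS; ring.
Qed.

End Antiderivative.

(** * Parity of binomial coefficients *)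

Section Binomials.

Lemma dvdn_mul_bin k c i : 2 ^ k %| i * 'C(c * 2 ^ k, i).
Proof.
case: i => [|i]; first by rewrite mul0n dvdn0.
by rewrite -mul_bin_diag -mulnA dvdn_mull // dvdn_mulr.
Qed.

Lemma even_bin k c i : 0 < i < 2 ^ k -> ~~ odd 'C(c * 2 ^ k, i).
Proof.
move=> /andP[i0 ltik]; apply/negP => odd_bin.
have := dvdn_mul_bin k c i; rewrite Gauss_dvdl; last first.
  by rewrite coprimeXl // coprime2n.
by move=> /(dvdn_leq i0); rewrite leqNgt ltik.
Qed.

(** By Pascal's rule and [even_bin], neighbouring entries of the row keep the parity of the initial
    1. *)
Lemma odd_bin_pred k c j : 0 < c -> j < 2 ^ k -> odd 'C((c * 2 ^ k).-1, j).
Proof.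
move=> c0; elim: j => [|j IHj] ltj; first by rewrite bin0.
have := @even_bin k c j.+1 ltj.
rewrite -(prednK (_ : 0 < c * 2 ^ k)) ?muln_gt0 ?c0 ?expn_gt0 // binS oddD.
by rewrite IHj ?addbT ?negbK // ltnW.
Qed.

End Binomials.

(** * Evaluation of the residue in the two cases *)

Section Main.

Local Open Scope ring_scope.

Lemma coefX1n n i : (('X + 1 : {poly int}) ^+ n)`_i = 'C(n, i)%:R.
Proof.
rewrite addrC exprDn coef_sum.
under eq_bigr => j _ do rewrite expr1n mul1r coefMn coefXn.
have [lein|ltni] := leqP i n.
  rewrite (bigD1 (inord i)) //= inordK // eqxx big1 ?addr0 ?natz // => j ne_j.
  case: eqP => [Dj|_]; last by rewrite mul0rn.
  by rewrite Dj inord_val eqxx in ne_j.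
rewrite bin_small // big1 // => j _.
case: eqP => [Dj|_]; last by rewrite mul0rn.
by have := ltn_ord j; rewrite -Dj ltnS leqNgt ltni.
Qed.

Lemma compX1n n : 'X^n \Po ('X + 1) = ('X + 1) ^+ n :> {poly int}.
Proof. by rewrite rmorphXn /= comp_polyX. Qed.

Lemma cong_mulr_scale (R : comNzRingType) (u d x y : R) :
  cong d x y -> cong (u * d) (u * x) (u * y).
Proof. by case=> e ->; exists e; ring. Qed.

(** Case l = 0. One more factor B above and below makes the exponent k + 1 even, so the denominator
    is even in X modulo 2^(s+2) and only the odd part of X^N B counts. *)
Lemma stirling2_cong_full s k K M N : odd k -> (0 < M)%N ->
  K.+1 = (2 ^ s.+2 * k)%N -> N = (M + k * 2 ^ s).*2 ->
  cong (2 ^+ s.+2) (stirling2 N K)%:R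
       (2 ^+ s.+1 * 'C(M.-1, (k * 2 ^ s).-1)%:R : int).
Proof.
move=> odd_k M0 DK DN.
have k0 : (0 < k)%N by case: (k) odd_k.
have D0 : (0 < k * 2 ^ s)%N by rewrite muln_gt0 k0 expn_gt0.
have := @stirling2_cong (2 ^ s.+2) k N K 0; rewrite addn0 => /(_ DK).
rewrite natrX => /cong_trans; apply.
rewrite {2}/fall big_ord0 mulr1 -(res_mulr _ _ (fall_monic 0 (2 ^ s.+2))) ?monic_exp ?fall_monic //.
rewrite -exprSr.
have [P [F [DB congP mP szP]]] := fall_block s.
have mP' := monic_compX2 mP.
set B := fall 0 _ in DB *; pose W := odd_block s.
have mB : B \is monic by apply: fall_monic.
have szB : size B = size (P \Po 'X^2) by rewrite size_fall size_compX2 szP expnS; lia.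
have congB2 : cong (2 ^+ s.+2) (B ^+ 2) ((P \Po 'X^2) ^+ 2).
  rewrite DB; set U := _ * 'X.
  exists ((P \Po 'X^2) * U + 2 * (P \Po 'X^2) * F + 2 ^+ s * (U + 2 * F) ^+ 2).
  rewrite !exprS; ring.
have Dk1 : k.+1 = (2 * k.+1./2)%N.
  by rewrite mul2n -[LHS]odd_double_half /= odd_k.
have pow2C : (2 ^+ s.+2 : int)%:P = 2 ^+ s.+2 :> {poly int}.
  by rewrite -polyC_pow2 natrX.
apply: cong_trans (res_cong_mod (p' := (P \Po 'X^2) ^+ k.+1) _ _ _ _ _) _.
- exact: monic_exp.
- exact: monic_exp.
- by rewrite !size_monic_exp ?szB.
- by rewrite pow2C Dk1 !exprM; apply: congX.
have -> : (P \Po 'X^2) ^+ k.+1 = (P ^+ k.+1) \Po 'X^2 by rewrite rmorphXn.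
pose H : nat := (M + k * 2 ^ s)%N.
have DXN : 'X^N = 'X^H \Po 'X^2 :> {poly int}.
  by rewrite rmorphXn /= comp_polyX -exprM mul2n -DN.
have -> : 'X^N * B = (2 ^+ s.+2 : int) *: ('X^N * F) + ((('X^H * P) \Po 'X^2)
           + (2 ^+ s.+1 : int) *: ((('X^H * W) \Po 'X^2) * 'X)).
  by rewrite -!mul_polyC pow2C -(natrX _ 2 s.+1) polyC_pow2 DB !comp_polyM -DXN; ring.
have mPk : P ^+ k.+1 \is monic by apply: monic_exp.
have mPk2 := monic_compX2 mPk.
rewrite !resD // !resZ // res_even // res_odd // add0r.
apply: (@cong_trans _ _ _ (2 ^+ s.+1 * res (P ^+ k.+1) ('X^H * W))).
  by exists (res (P ^+ k.+1 \Po 'X^2) ('X^N * F)); rewrite addrC.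
(* Beside the factor 2^(s+1), the residue is needed modulo 2 only, where [P] becomes
   [sq_block s]. *)
rewrite exprSr; apply: cong_mulr_scale.
have congPY : cong (2 : int)%:P P (sq_block s).
  by apply: (cong_dvd (d' := 2 ^+ s)); rewrite polyC_natr -exprS; exact: congP.
apply: cong_trans (res_cong_mod (p' := sq_block s ^+ k.+1) _ _ _ _ _) _.
- exact: monic_exp.
- by rewrite monic_exp ?sq_block_monic.
- rewrite [LHS]size_monic_exp // [RHS]size_monic_exp ?sq_block_monic //; congr (_.-1 * _).+1.
  by transitivity (2 ^ s.+1).+1; [exact: szP | rewrite size_sq_block].
- exact: congX.
rewrite (_ : res _ _ = 'C(M.-1, (k * 2 ^ s).-1)%:R); first exact: cong_refl.
(* Cancelling [mq]'s polynomial leaves Z^(M-1) / (Z - 1)^(k 2^s). *)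
rewrite -coefX1n -compX1n -res_shift //.
have mq : 'X^(k.+1 * 2 ^ s) * ('X - 1 : {poly int}) ^+ (2 ^ s) \is monic.
  by rewrite monicMl ?monicXn ?monic_exp ?X1_monic.
rewrite -[RHS](res_mulr _ _ mq) ?monic_exp ?X1_monic //.
congr res.
  by rewrite /sq_block -exprM exprMn mulnC mulSn !exprD; ring.
rewrite /W /odd_block mulrA -exprD mulrA -exprD; congr ('X^_ * _).
by rewrite /H mulSn; have := expn_gt0 2 s; lia.
Qed.

(** Modulo 2^(s+1) the denominator is already even in X, so only the odd part of the completing
    factors survives. *)
Lemma stirling2_cong_odd_part s k K M N l : (0 < k)%N ->
  (K.+1 + l = 2 ^ s.+2 * k)%N -> N = (M + k * 2 ^ s).*2 ->
  cong (2 ^+ s.+1) (stirling2 N K)%:R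
    (('X + 1) ^+ M * (odd_poly (fall K.+1%:R l) \Po ('X + 1)))`_(k * 2 ^ s).-1.
Proof.
move=> k0 DK DN.
have D0 : (0 < k * 2 ^ s)%N by rewrite muln_gt0 k0 expn_gt0.
have := stirling2_cong N DK.
rewrite natrX exprSr => /cong_dvd/cong_trans; apply.
set T := fall _ l.
have [P [F [DB congP mP szP]]] := fall_block s.
have mY := sq_block_monic s; have mY2 := monic_compX2 mY.
set B := fall 0 _ in DB *.
have mB : B \is monic by apply: fall_monic.
have szB : size B = size (sq_block s \Po 'X^2).
  by rewrite size_fall size_compX2 size_sq_block expnS; lia.
have pow2C : (2 ^+ s.+1 : int)%:P = 2 ^+ s.+1 :> {poly int}.
  by rewrite -polyC_pow2 natrX.
have congB : cong (2 ^+ s.+1) B (sq_block s \Po 'X^2).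
  case: congP => e De; rewrite DB De.
  exists ((e \Po 'X^2) + (odd_block s \Po 'X^2) * 'X + 2 * F).
  by rewrite comp_polyD comp_polyM -!pow2C comp_polyC !pow2C (exprS _ s.+1); ring.
apply: cong_trans (res_cong_mod (p' := (sq_block s \Po 'X^2) ^+ k) _ _ _ _ _) _.
- exact: monic_exp.
- exact: monic_exp.
- by rewrite !size_monic_exp ?szB.
- by rewrite pow2C; apply: congX.
have -> : (sq_block s \Po 'X^2) ^+ k = (sq_block s ^+ k) \Po 'X^2.
  by rewrite [RHS]rmorphXn.
pose H : nat := (M + k * 2 ^ s)%N.
have DXN : 'X^N = 'X^H \Po 'X^2 :> {poly int}.
  by rewrite rmorphXn /= comp_polyX -exprM mul2n -DN.
have mYk : sq_block s ^+ k \is monic by apply: monic_exp.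
have -> : 'X^N * T = (('X^H * even_poly T) \Po 'X^2) + ((('X^H * odd_poly T) \Po 'X^2) * 'X).
  by rewrite -{1}(poly_even_odd T) !comp_polyM -DXN; ring.
rewrite resD ?monic_compX2 // res_even // res_odd // add0r.
rewrite -compX1n -comp_polyM -res_shift //.
rewrite (_ : res _ _ = res (('X - 1) ^+ (k * 2 ^ s)) ('X^M * odd_poly T)).
  exact: cong_refl.
rewrite -[RHS](@res_mulr _ _ 'X^(k * 2 ^ s)) ?monicXn ?monic_exp ?X1_monic //.
congr res; last by rewrite /H exprD; ring.
by rewrite /sq_block -exprM exprMn mulnC mulrC.
Qed.

(** Integration by parts writes the quantity as 2 (D u - M v), where 2^s divides D, u is even and
    2^(s+1) divides M. *)
Lemma odd_part_coef_dvd s k c mu (e : int) l : (2 < k)%N -> (l < 2 ^ s.+2)%N ->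
  (s < mu)%N -> (k * 2 ^ s < 2 ^ mu)%N ->
  exists2 o, odd o & (2 ^+ s.+2 %| (o * 2 ^ digit_sum s.+2 l)%:R *
   (('X + 1) ^+ (c * 2 ^ mu) * (odd_poly (fall e l) \Po ('X + 1)))`_(k * 2 ^ s).-1)%Z.
Proof.
move=> k2 ltl ltmu ltD; have [o [Q [odd_o DQ]]] := fall_antideriv e ltl.
exists o => //; move: (o * _)%N DQ => O DQ.
set T := fall e l in DQ *; set M := (c * 2 ^ mu)%N; set D := (k * 2 ^ s)%N in ltD *.
have D0 : (0 < D)%N by rewrite muln_gt0 expn_gt0 /= (ltn_trans _ k2).
have lel : (l.+2 <= D.*2)%N.
  rewrite /D; move: ltl; rewrite !expnS; have := expn_gt0 2 s.
  have : (3 * 2 ^ s <= k * 2 ^ s)%N by rewrite leq_mul2r k2 orbT.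
  lia.
pose G := even_poly Q \Po ('X + 1).
have szQe : (size (even_poly Q) <= D)%N.
  apply/leq_sizeP => j leDj; rewrite coef_even_poly.
  have := congr1 (fun p : {poly int} => p`_j.*2.-1) DQ.
  have -> : Q`_j.*2 = Q`_j.*2.-1.+1 by rewrite prednK //; lia.
  rewrite coef_deriv -polyC_natr mul_polyC coefZ [T`__]nth_default ?size_fall; last lia.
  by rewrite mulr0 => /eqP; rewrite -mulr_natr mulf_eq0 natz eqz_nat orbF => /eqP.
have GD : G`_D = 0.
  by rewrite coef_top_shift ?nth_default // ltnW.
(* The odd part of Q' is the derivative of Qe(X^2), that is 2 X Qe'(X^2), for the even part Qe of
   Q. *)
have DG : O%:R * (odd_poly T \Po ('X + 1)) = 2 * G^`().
  rewrite /G deriv_comp derivD derivX derivC addr0 mulr1.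
  rewrite -!polyC_natr !mul_polyC -!comp_polyZ; congr (_ \Po _).
  apply/polyP => i; rewrite !coefZ coef_deriv coef_odd_poly coef_even_poly.
  have := congr1 (fun p : {poly int} => p`_i.*2.+1) DQ.
  rewrite coef_deriv -polyC_natr mul_polyC coefZ => <-.
  by rewrite mulr_natl -mulrnA muln2 doubleS.
(* The term i = 0 vanishes by degree; the others contain even binomials, as 0 < i <= D < 2^mu. *)
have evenFG : (2 %| ((('X + 1) ^+ M * G)`_D))%Z.
  rewrite coefM; apply: rpred_sum => i _; case: (posnP i) => [->|i0]; first by rewrite subn0 GD mulr0.
  apply: dvdz_mulr; rewrite coefX1n !natz dvdzE !absz_nat dvdn2 even_bin //.
  by rewrite i0 (leq_ltn_trans _ ltD) // -ltnS.
have -> : O%:R * (('X + 1) ^+ M * (odd_poly T \Po ('X + 1)))`_D.-1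
   = 2 * ((('X + 1) ^+ M * G)`_D * D%:R - M%:R * (('X + 1) ^+ M.-1 * G)`_D.-1).
  rewrite -coefZ -mul_polyC polyC_natr mulrCA DG.
  have := congr1 (fun p : {poly int} => p`_D.-1) (derivM (('X + 1) ^+ M) G).
  rewrite coef_deriv prednK // coefD [_ * D%:R]mulr_natr => ->.
  rewrite deriv_exp derivD derivX derivC addr0 mul1r.
  have -> : (('X + 1) ^+ M.-1 *+ M * G)`_D.-1 = M%:R * (('X + 1) ^+ M.-1 * G)`_D.-1.
    by rewrite -[_ *+ M]mulr_natl -mulrA -polyC_natr mul_polyC coefZ.
  rewrite (addrC (M%:R * _)) addrK.
  by rewrite mulrCA -polyC_natr mul_polyC coefZ.
rewrite exprS dvdz_mul2l // rpredB //.
  case/dvdzP: evenFG => z ->; rewrite /D natrM natrX.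
  have -> : z * 2 * (k%:R * 2%:R ^+ s) = 2 ^+ s.+1 * (z * k%:R) by rewrite exprS; ring.
  exact: dvdz_mulr.
apply: dvdz_mulr; rewrite /M natrM natrX dvdz_mull //.
by rewrite -(subnKC ltmu) exprD dvdz_mulr.
Qed.

End Main.

(** * From divisibility to valuations *)

Lemma dvdz_pow2_nat k x : ((2 ^+ k)%R %| x%:R%R)%Z = (2 ^ k %| x).
Proof. by rewrite natz -[(2 ^+ k)%R](natrX _ 2 k) natz. Qed.

Lemma cong_dvdz (d x y : int) : cong d x y -> (d %| x)%Z = (d %| y)%Z.
Proof.
case=> e ->; apply/idP/idP => [dvd_d|dvd_y].
  by rewrite -(addrK (d * e)%R y) rpredB // dvdz_mulr.
by rewrite rpredD // dvdz_mulr.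
Qed.

Theorem theorem1p4 (a b c m n : nat)
    (ha : 1 <= a) (hb : 1 <= b) (hc : 1 <= c) (hm : 1 <= m) (hn : 1 <= n)
    (ha_lt : a < 2 ^ (n + 1))
    (hm_ge : n + 2 + trunc_log 2 b <= m)
    (hc_odd : odd c) :
  (a = 2 ^ (n + 1) - 1 ->
     logn 2 (stirling2 (c * 2 ^ m + b * 2 ^ (n + 1) + 2 ^ n)
                       (b * 2 ^ (n + 2) + a)) = n)
  /\
  (a < 2 ^ (n + 1) - 1 ->
     binary_digit_sum a <=
     logn 2 (stirling2 (c * 2 ^ m + b * 2 ^ (n + 1) + 2 ^ n)
                       (b * 2 ^ (n + 2) + a))).
Proof.
case: n hn ha_lt hm_ge => // s _ ha_lt hm_ge.
case: m hm hm_ge => // mu _ hm_ge.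
set K := b * _ + a; set N := c * _ + _ + _.
pose k := b.*2.+1; pose M := c * 2 ^ mu.
have pow0 : 0 < 2 ^ s by rewrite expn_gt0.
(* The lower bound on m enters here, with n = s + 1 and m = mu + 1. *)
have ltD : k * 2 ^ s < 2 ^ mu.
  have ltb : b < 2 ^ (trunc_log 2 b).+1 by apply: trunc_log_ltn.
  have lt1 : k < 2 ^ (trunc_log 2 b).+2 by rewrite /k [2 ^ _]expnS; lia.
  apply: (@leq_trans (2 ^ ((trunc_log 2 b).+2 + s))).
    by rewrite expnD ltn_pmul2r.
  by rewrite leq_exp2l //; lia.
have ltmu : s < mu by lia.
have M0 : 0 < M by rewrite muln_gt0 hc expn_gt0.
have odd_k : odd k by rewrite /k /= odd_double.
have DN : N = (M + k * 2 ^ s).*2.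
  by rewrite /N /M /k addn1 !expnS; lia.
have ha_lt' : a < 2 ^ s.+2 by rewrite addn1 in ha_lt.
have DK l : a + l = (2 ^ s.+2).-1 -> K.+1 + l = 2 ^ s.+2 * k.
  by move=> Dl; rewrite /K /k addn2 expnS; move: ha_lt' Dl; lia.
have S0 : 0 < stirling2 N K.
  apply: stirling2_gt0; rewrite addn_gt0 ha orbT /=.
  have leM : 2 ^ mu <= M by rewrite leq_pmull.
  have : K < 2 ^ s.+2 * k.
    have D : a + ((2 ^ s.+2).-1 - a) = (2 ^ s.+2).-1 by move: ha_lt'; lia.
    by have := DK _ D; lia.
  rewrite DN /k; move: ltD leM; rewrite /k !expnS; nia.
rewrite addn1 subn1; split=> [Da|lta].
  have := @stirling2_cong_full s k K M N odd_k M0.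
  rewrite -(DK 0) ?addn0 // => /(_ erefl DN) S_cong.
  have odd_bin : odd 'C(M.-1, (k * 2 ^ s).-1).
    by apply: odd_bin_pred => //; apply: leq_ltn_trans (leq_pred _) ltD.
  apply/eqP; rewrite eqn_leq.
  apply/andP; split.
    rewrite leqNgt -pfactor_dvdn // -dvdz_pow2_nat (cong_dvdz S_cong) (exprSr _ s.+1).
    by rewrite dvdz_mul2l ?expf_neq0 // natz dvdzE absz_nat dvdn2 odd_bin.
  have : cong (2 ^+ s.+1 : int)%R (stirling2 N K)%:R%R (2 ^+ s.+1 * 'C(M.-1, (k * 2 ^ s).-1)%:R)%R.
    by apply: (@cong_dvd _ _ 2%R); rewrite -exprSr; exact: S_cong.
  by move/cong_dvdz; rewrite dvdz_pow2_nat -pfactor_dvdn // => ->; rewrite dvdz_mulr ?dvdzz.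
pose l := (2 ^ s.+2).-1 - a.
have Dl : a + l = (2 ^ s.+2).-1 by rewrite /l; move: ha_lt'; lia.
have ltl : 0 < l < 2 ^ s.+2 by rewrite /l; move: lta ha; lia.
have k2 : 2 < k by rewrite /k; lia.
rewrite (digit_sum_binary ha_lt') -pfactor_dvdn // -dvdz_pow2_nat.
have Dd := digit_sum_compl Dl.
have l_gt0 := digit_sum_gt0 ltl.
have [_ ltl'] := andP ltl.
have [o odd_o] := odd_part_coef_dvd c K.+1%:R%R k2 ltl' ltmu ltD.
have := stirling2_cong_odd_part (ltnW (ltnW k2)) (DK l Dl) DN.
rewrite -/M; move: (_`__)%R => x S_cong dvd_x.
(* As l > 0 has a nonzero digit, s_2(a) <= s + 1, so the congruence modulo 2^(s+1) is enough. *)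
have -> : ((2 ^+ digit_sum s.+2 a)%R %| (stirling2 N K)%:R%R)%Z = ((2 ^+ digit_sum s.+2 a)%R %| x)%Z.
  apply: cong_dvdz; apply: (cong_dvd (d' := (2 ^+ (s.+1 - digit_sum s.+2 a))%R)).
  by rewrite -exprD subnKC //; lia.
move: dvd_x.
(* Digits of a and l are complementary; cancelling 2^(s_2(l)) and the odd [o] leaves 2^(s_2(a)). *)
have -> : (2 ^+ s.+2 = 2 ^+ digit_sum s.+2 l * 2 ^+ digit_sum s.+2 a :> int)%R.
  by rewrite -exprD addnC Dd.
rewrite natrM natrX [(o%:R * _)%R]mulrC -mulrA dvdz_mul2l ?expf_neq0 //.
by rewrite Gauss_dvdzr // coprimezE !natz !abszX !absz_nat coprimeXl // coprime2n.
Qed.
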